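(* Let $X$ be a second countable Baire complex topological vector space and let $\Gamma\subset\mathcal{B}(X)$. If $\Gamma$ satisfies the criterion of diskcyclicity, then $\mathbb{D}C(\Gamma)$ is a dense subset of $X$. As a consequence, $\Gamma$ is diskcyclic.
   Context: $\mathcal{B}(X)$ is the set of all continuous linear operators on $X$, and $\mathbb{D}=\{\alpha\in\mathbb{C}:|\alpha|\le 1\}$. For $\Gamma\subset\mathcal{B}(X)$ and $x\in X$, the disk orbit of $x$ under $\Gamma$ is $\mathbb{D}Orb(\Gamma,x)=\{\alpha Tx:\alpha\in\mathbb{D},\,T\in\Gamma\}$. A vector $x$ is a diskcyclic vector for $\Gamma$ if $\mathbb{D}Orb(\Gamma,x)$ is dense in $X$; $\mathbb{D}C(\Gamma)$ is the set of all diskcyclic vectors for $\Gamma$, and $\Gamma$ is diskcyclic if $\mathbb{D}C(\Gamma)\neq\emptyset$. The set $\Gamma$ satisfies the criterion of diskcyclicity if there exist two dense subsets $X_0,Y_0$ of $X$, a sequence $(\alpha_k)$ in $\mathbb{D}\setminus\{0\}$, a sequence $(T_k)$ in $\Gamma$, and a sequence of maps $S_k:Y_0\to X$ (not assumed linear or continuous) such that, as $k\to\infty$: (i) $\alpha_kT_kx\to 0$ for all $x\in X_0$; (ii) $\alpha_k^{-1}S_ky\to 0$ for all $y\in Y_0$; (iii) $T_kS_ky\to y$ for all $y\in Y_0$. *)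

(* Defs.v *)
From HB Require Import structures.
From mathcomp Require Import all_boot all_order all_algebra.
From mathcomp Require Import complex.
From mathcomp Require Import boolp classical_sets functions cardinality reals.
From mathcomp Require Import topology tvs.

Set Implicit Arguments.
Unset Strict Implicit.
Unset Printing Implicit Defensive.

Import Order.TTheory GRing.Theory Num.Theory.

Local Open Scope classical_set_scope.
Local Open Scope ring_scope.

Definition baire_space (T : topologicalType) :=
  forall F : nat -> set T,
    (forall n, open (F n) /\ dense (F n)) -> dense (\bigcap_n F n).

Definition disk (R : realType) : set R[i] := [set a : R[i] | `|a| <= 1].

Section Diskcyclicity.
Context (R : realType) (X : topologicalLmodType R[i]).
Implicit Types (Gamma : set {linear X -> X}) (x : X).

Definition continuous_operators : set {linear X -> X} :=
  [set T : {linear X -> X} | continuous T].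

Definition disk_orbit Gamma x : set X :=
  [set a *: T x | a in @disk R & T in Gamma].

Definition diskcyclic_vector Gamma x := dense (disk_orbit Gamma x).

Definition diskcyclic_vectors Gamma : set X :=
  [set x | diskcyclic_vector Gamma x].

Definition diskcyclic Gamma := diskcyclic_vectors Gamma !=set0.

(* The maps S k have the subtype of elements of Y0 as domain; \val is the
   inclusion of Y0 in X. *)
Definition diskcyclicity_criterion Gamma :=
  exists (X0 Y0 : set X) (a : nat -> R[i]) (T : nat -> {linear X -> X})
    (S : nat -> Y0 -> X),
    [/\ dense X0 /\ dense Y0,
        (forall k, disk (a k) /\ a k != 0) /\ (forall k, Gamma (T k)),
        (forall x, X0 x -> a k *: T k x @[k --> \oo] --> (0 : X)),
        (forall y : Y0, (a k)^-1 *: S k y @[k --> \oo] --> (0 : X)) &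
        (forall y : Y0, T k (S k y) @[k --> \oo] --> (\val y : X))].

End Diskcyclicity.

(* Main.v *)
Require Import Defs.
From HB Require Import structures.
From mathcomp Require Import all_boot all_order all_algebra.
From mathcomp Require Import complex.
From mathcomp Require Import boolp classical_sets functions cardinality reals.
From mathcomp Require Import topology tvs.

Set Implicit Arguments.
Unset Strict Implicit.
Unset Printing Implicit Defensive.

Import Order.TTheory GRing.Theory Num.Theory.

Local Open Scope classical_set_scope.
Local Open Scope ring_scope.

(** A vector is diskcyclic exactly when its disk orbit meets every nonempty
    member of a countable basis. For each such open set U, the vectors whose
    orbit meets U form an open set by continuity of the operators, and a dense
    set by the criterion; the Baire property then gives density of the
    countable intersection. *)

(** The family is reindexed by [nat] along an injection [f] of [D] into [nat]: the set numbered [n]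
    is [V i] when [n = f i] with [i] in [D], and the whole space when [n] is not such a value. *)
Lemma baire_bigcap_countable (T : topologicalType) (I : Type) (D : set I)
    (V : I -> set T) :
  baire_space T -> countable D ->
  (forall i, D i -> open (V i) /\ dense (V i)) ->
  dense (\bigcap_(i in D) V i).
Proof.
move=> baireT /countable_injP[f finj] VP.
pose F n := \bigcap_(i in D `&` f @^-1` [set n]) V i.
suff /baireT : forall n, open (F n) /\ dense (F n).
  move=> denseF O O0 /(denseF O O0)[x [Ox Fx]]; exists x; split=> // i Di.
  exact: (Fx (f i)).
move=> n; have [[i [Di fi]]|nD] := pselect (exists i, D i /\ f i = n).
  have -> : F n = V i.
    apply/seteqP; split=> [x /(_ i)|x Vx j [Dj fj]]; first exact.
    suff <- : i = j by [].
    by apply: finj; rewrite ?inE// fi fj.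
  exact: VP.
(* No index of [D] is sent to [n], so the intersection is over an empty family. *)
have -> : F n = setT.
  apply/seteqP; split=> // x _ i [Di fi].
  by case: nD; exists i.
by split=> [|O [x Ox] _]; [exact: openT|exists x].
Qed.

Lemma dense_basis (T : topologicalType) (B : set (set T)) (S : set T) :
  basis B -> (forall U, B U -> U !=set0 -> U `&` S !=set0) -> dense S.
Proof.
move=> [_ Bnbhs] BS O [x Ox] oO.
have [U [BU Ux] UO] := Bnbhs x O (open_nbhs_nbhs (conj oO Ox)).
have [z [Uz Sz]] := BS U BU (ex_intro _ x Ux).
by exists z; split=> //; exact: UO.
Qed.

Lemma nmod_cvgD (X : TopologicalNmodule.type) (f g : nat -> X) (x y : X) :
  f k @[k --> \oo] --> x -> g k @[k --> \oo] --> y ->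
  f k + g k @[k --> \oo] --> x + y.
Proof. exact: continuous2_cvg (add_continuous (x, y)). Qed.

Lemma lmod_scaler_continuous (K : numDomainType) (X : topologicalLmodType K)
    (a : K) :
  continuous (fun x : X => a *: x).
Proof.
move=> x; apply: (continuous2_cvg _ (scale_continuous (a, x))) => //.
exact: cvg_cst.
Qed.

Section Hitting.
Context (R : realType) (X : topologicalLmodType R[i]).
Implicit Types (Gamma : set {linear X -> X}) (U : set X).

Definition hits Gamma U : set X := [set x | U `&` disk_orbit Gamma x !=set0].

(** The set is a union of preimages of [U] under the continuous maps [a *: T], with [a] in the disk
    and [T] in [Gamma]. *)
Lemma hits_open Gamma U :
  Gamma `<=` @continuous_operators R X -> open U -> open (hits Gamma U).
Proof.
move=> Gcont oU.
have -> : hits Gamma U =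
    \bigcup_(p in [set p : R[i] * {linear X -> X} | disk p.1 /\ Gamma p.2])
      ((fun x => p.1 *: p.2 x) @^-1` U).
  apply/seteqP; split=> x.
    by move=> [u [Uu [a Da [T GT au]]]]; exists (a, T); rewrite //= au.
  move=> [[a T] [/= Da GT] Ux]; exists (a *: T x); split=> //.
  by exists a => //; exists T.
apply: bigcup_open => -[a T] [/= Da GT].
apply: open_comp => // x _.
apply: (@continuous_comp _ _ _ T (fun u : X => a *: u)).
  exact: Gcont.
exact: lmod_scaler_continuous.
Qed.

(* The vectors [x + (a k)^-1 *: S k y] tend to [x], while their images under
   [a k *: T k] are [a k *: T k x + T k (S k y)], which tend to [y]. *)
Lemma hits_dense Gamma U :
  diskcyclicity_criterion Gamma -> open U -> U !=set0 -> dense (hits Gamma U).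
Proof.
move=> [X0 [Y0 [a [T [S [[dX0 dY0] [aP GT] aT0 aS0 TSy]]]]]] oU U0 W W0 oW.
(* The limits of the criterion are available only on [X0] and [Y0], so [x] is taken in [W] and [X0],
   and [y] in [U] and [Y0]. *)
have [x [Wx X0x]] := dX0 W W0 oW.
have [y [Uy Y0y]] := dY0 U U0 oU.
have Y0y' : y \in Y0 by rewrite inE.
pose y' : Y0 := SigSub Y0y'.
pose z k := x + (a k)^-1 *: S k y'.
have zx : z k @[k --> \oo] --> x.
  rewrite -(addr0 x).
  by apply: nmod_cvgD; [exact: cvg_cst|exact: aS0].
have azy : a k *: T k (z k) @[k --> \oo] --> y.
  have -> : (fun k => a k *: T k (z k)) =
      (fun k => a k *: T k x + T k (S k y')).
    apply/funext => k; rewrite linearD linearZ scalerDr scalerA mulfV ?scale1r//.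
    by have [] := aP k.
  rewrite -(add0r y).
  by apply: nmod_cvgD; [exact: aT0|exact: TSy].
have nearW : \forall k \near \oo, W (z k).
  by apply: zx; exact: open_nbhs_nbhs.
have nearU : \forall k \near \oo, U (a k *: T k (z k)).
  by apply: azy; exact: open_nbhs_nbhs.
have [k [Wk Uk]] := filter_ex (filterI nearW nearU).
exists (z k); split=> //; exists (a k *: T k (z k)); split=> //.
by exists (a k); [have [] := aP k|exists (T k)].
Qed.

End Hitting.

Theorem theorem3p23 (R : realType) (X : topologicalLmodType R[i])
    (Gamma : set {linear X -> X}) :
  @second_countable X -> baire_space X ->
  Gamma `<=` @continuous_operators R X ->
  diskcyclicity_criterion Gamma ->
  dense (diskcyclic_vectors Gamma) /\ diskcyclic Gamma.
Proof.
move=> [B cB basisB] baireX Gcont crit.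
suff dC : dense (diskcyclic_vectors Gamma).
  split=> //.
  (* The whole space is a nonempty open set, as it contains [0], so a dense set meets it. *)
  by have [x [_ Cx]] := dC setT (ex_intro _ 0 I) openT; exists x.
(* The empty set may belong to the basis; it is left out because [hits Gamma set0] is empty and
   hence not dense. *)
have dH : dense (\bigcap_(U in B `&` [set U | U !=set0]) hits Gamma U).
  apply: baire_bigcap_countable => // [|U [BU U0]].
    exact: sub_countable (subset_card_le (@subIsetl _ _ _)) cB.
  have oU := basisB.1 _ BU.
  by split; [exact: hits_open|exact: hits_dense].
move=> O O0 /(dH O O0)[x [Ox Hx]]; exists x; split=> //.
by apply: dense_basis basisB _ => U BU U0; exact: Hx.
Qed.
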